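(* For each $i\in\mathbb Z$ the sequence $(A^k\mathfrak e_i)_{k\in\mathbb N}$ is not a Bessel sequence in $\mathrm{BL}$.
   Context: $\mathbb N$ includes zero. $\mathrm{BL}:=PW_{1/2}$ is the space of band-limited functions $g:\mathbb R\to\mathbb C$ of the form $g(t)=\int_{-1/2}^{1/2}e^{2\pi \mathrm{i}xt}\phi(x)\,dx$ with $\phi\in L^2(-1/2,1/2)$, equipped with the $L^2(\mathbb R)$-norm and scalar product; it is a Hilbert space. $B:\mathrm{BL}\to\mathrm{BL}$ is the operator $Bu:=u''$, which is a bounded selfadjoint operator in $\mathrm{BL}$ with spectrum $[-1/4,0]$. Fix $\delta>0$ and put $A:=e^{\delta B}$, a positive definite bounded selfadjoint operator in $\mathrm{BL}$. For $i\in\mathbb Z$, $\mathfrak e_i\in\mathrm{BL}$ is the translate $\mathfrak e_i(t)=\operatorname{sinc}(t-i)$, where $\operatorname{sinc}(t)=\sin(\pi t)/(\pi t)$ (with $\operatorname{sinc}(0)=1$). A sequence $(y_k)_{k\in\mathbb N}$ in a Hilbert space $\mathcal H$ is a Bessel sequence if there is $C>0$ such that $\sum_{k\in\mathbb N}|\langle y,y_k\rangle|^2\le C\|y\|^2$ for all $y\in\mathcal H$. *)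

(* Defs.v *)
From HB Require Import structures.
From mathcomp Require Import all_boot all_order all_algebra.
From mathcomp Require Import all_classical all_reals all_analysis.
From mathcomp Require Import complex.
Set Implicit Arguments.
Unset Strict Implicit.
Unset Printing Implicit Defensive.
Import Order.TTheory GRing.Theory Num.Theory.
Import numFieldTopology.Exports numFieldNormedType.Exports.
Local Open Scope classical_set_scope.
Local Open Scope ring_scope.

Section BandLimited.
Context {R : realType}.
Local Notation mu := (@lebesgue_measure R).
Implicit Types (f g u y phi : R -> R[i]) (T : (R -> R[i]) -> R -> R[i]).

Definition re_fun f : R -> R := fun t => complex.Re (f t).
Definition im_fun f : R -> R := fun t => complex.Im (f t).

Definition modulus (z : R[i]) : R := ComplexField.Normc.normc z.

Definition expi (theta : R) : R[i] := (cos theta +i* sin theta)%C.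

(* MathComp-Analysis integrates real-valued functions only, and R[i] carries no
   R-normed-module structure: integration and differentiation of
   complex-valued functions of a real variable are done componentwise. *)
Definition cintegral (D : set R) f : R[i] :=
  (Rintegral mu D (re_fun f) +i* Rintegral mu D (im_fun f))%C.

Definition cderive f : R -> R[i] :=
  fun t => (derive1 (re_fun f) t +i* derive1 (im_fun f) t)%C.

Definition band : set R := [set` `]- (2^-1), 2^-1[ ].

Definition L2_band phi : Prop :=
  [/\ measurable_fun band (re_fun phi), measurable_fun band (im_fun phi) &
      (\int[mu]_(x in band) (modulus (phi x) ^+ 2)%:E < +oo)%E].

(* The elements of BL are continuous, so they are genuine functions, not
   classes modulo almost-everywhere equality. *)
Definition BL : set (R -> R[i]) :=
  [set g | exists2 phi, L2_band phi &
     forall t, g t = cintegral band (fun x => expi (2 * pi * x * t) * phi x)].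

(* Extended-real valued, so that no function of infinite norm is assigned a
   junk finite value. *)
Definition L2norm f : \bar R := Lnorm mu 2%:E (fun t => (modulus (f t))%:E).

Definition L2dot f g : R[i] := cintegral setT (fun t => f t * (g t)^*%C).

Definition opB u : R -> R[i] := cderive (cderive u).

Definition exp_partial_sum T u (N : nat) : R -> R[i] :=
  fun t => \sum_(n < N) (n`!%:R)^-1 * iter n T u t.

(* e^T u is the sum of the exponential series of the operator T at u, taken in
   the norm of BL; the limit is unique because distinct elements of BL differ
   in norm. The value 0 is only used if the series diverges, which does not
   happen for a bounded operator T of BL and u in BL. *)
Definition BL_exp T u : R -> R[i] :=
  xget (fun=> 0)
    [set g | BL g /\
       (fun N => L2norm (fun t => exp_partial_sum T u N t - g t)) @ \oo
         --> (0 : \bar R)].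

Definition opA (delta : R) : (R -> R[i]) -> R -> R[i] :=
  BL_exp (fun u t => (delta%:C)%C * opB u t).

Definition sinc (t : R) : R := if t == 0 then 1 else sin (pi * t) / (pi * t).

Definition sinc_translate (i : int) : R -> R[i] :=
  fun t => ((sinc (t - i%:~R))%:C)%C.

Definition bessel_BL (y_ : nat -> R -> R[i]) : Prop :=
  exists2 C : R, 0 < C &
    forall y, BL y ->
      (\sum_(0 <= k <oo) (modulus (L2dot y (y_ k)) ^+ 2)%:E
         <= C%:E * L2norm y ^+ 2)%E.

End BandLimited.

(* Main.v *)
Require Import Defs.
From mathcomp Require Import all_boot all_order all_algebra.
From mathcomp Require Import all_classical all_reals all_analysis.
From mathcomp Require Import measurable_realfun complex ring lra.

(** On the Fourier side A is multiplication by [m(x) = exp (- 4 pi^2 delta x^2)],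
    so [A^k e_i] is the translate by [i] of the transform [g_k] of the Gaussian
    [m^k].  Since the mass [G_k = g_k(0)] of [m^k] concentrates near [x = 0],
    [g_k / G_k] tends to 1 pointwise while staying bounded by 1.  Hence for the
    translate [y] of the Fejer kernel, which is band-limited, nonnegative and
    integrable, dominated convergence gives [<y, A^k e_i> ~ G_k * \int y] with
    [\int y > 0].  As [G_k] is at least a constant times [k^(-1/2)], the series
    of the [|<y, A^k e_i>|^2] dominates a multiple of the harmonic series.
    To identify [A^k e_i], whose definition involves a limit in norm, one shows
    that the exponential series converges in [L^2(R)] (integration by parts
    bounds the transform of a [C^1] symbol by a multiple of [(1 + t^2)^(-1/2)]),
    and that limits are unique because elements of BL are continuous.  *)

Set Implicit Arguments.
Unset Strict Implicit.
Unset Printing Implicit Defensive.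
Import Order.TTheory GRing.Theory Num.Theory.
Import numFieldTopology.Exports numFieldNormedType.Exports.
Local Open Scope classical_set_scope.
Local Open Scope ring_scope.

(** * Continuity and differentiation rules for pointwise expressions *)

Section RealCalculus.
Context {R : realType}.
Implicit Types (f g : R -> R) (x a b : R).

Lemma ctsD f g : continuous f -> continuous g -> continuous (fun x => f x + g x).
Proof. by move=> cf cg x; apply: cvgD; [exact: cf|exact: cg]. Qed.

Lemma ctsB f g : continuous f -> continuous g -> continuous (fun x => f x - g x).
Proof. by move=> cf cg x; apply: cvgB; [exact: cf|exact: cg]. Qed.

Lemma ctsM f g : continuous f -> continuous g -> continuous (fun x => f x * g x).
Proof. by move=> cf cg x; apply: cvgM; [exact: cf|exact: cg]. Qed.

Lemma ctsN f : continuous f -> continuous (fun x => - f x).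
Proof. by move=> cf x; apply: cvgN; exact: cf. Qed.

Lemma ctsX f n : continuous f -> continuous (fun x => f x ^+ n).
Proof.
move=> cf; elim: n => [|n IH]; first exact: cst_continuous.
by under eq_fun do rewrite exprS; exact: ctsM.
Qed.

Lemma cts_cos f : continuous f -> continuous (fun x => cos (f x)).
Proof. by move=> cf x; apply: continuous_comp; [exact: cf|exact: continuous_cos]. Qed.

Lemma cts_sin f : continuous f -> continuous (fun x => sin (f x)).
Proof. by move=> cf x; apply: continuous_comp; [exact: cf|exact: continuous_sin]. Qed.

Lemma cts_expR f : continuous f -> continuous (fun x => expR (f x)).
Proof. by move=> cf x; apply: continuous_comp; [exact: cf|exact: continuous_expR]. Qed.

Lemma cts_norm f : continuous f -> continuous (fun x => `|f x|).
Proof. by move=> cf x; apply: cvg_norm; exact: cf. Qed.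

Lemma cts_sum (F : nat -> R -> R) n : (forall k, continuous (F k)) ->
  continuous (fun x => \sum_(k < n) F k x).
Proof.
move=> cF; elim: n => [|n IH].
  by under eq_fun do rewrite big_ord0; exact: cst_continuous.
by under eq_fun do rewrite big_ord_recr/=; exact: ctsD.
Qed.

Lemma cts_id : continuous (fun x : R => x). Proof. by move=> x; exact: cvg_id. Qed.

Lemma deriveB_val f g x a b : is_derive x 1 f a -> is_derive x 1 g b ->
  is_derive x 1 (fun y => f y - g y) (a - b).
Proof. by move=> df dg; exact: (is_deriveB df dg). Qed.

Lemma deriveM_val f g x a b : is_derive x 1 f a -> is_derive x 1 g b ->
  is_derive x 1 (fun y => f y * g y) (a * g x + f x * b).
Proof.
move=> df dg; apply: is_derive_eq (is_deriveM df dg) _.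
by rewrite addrC mulrC.
Qed.

Lemma derive_comp_val f g x a b : is_derive x 1 g b -> is_derive (g x) 1 f a ->
  is_derive x 1 (fun y => f (g y)) (b * a).
Proof.
by move=> dg df; apply: is_derive_eq (is_derive1_comp df dg) _; rewrite mulrC.
Qed.

Lemma derive_continuous f (df : R -> R) : (forall x, is_derive x 1 f (df x)) ->
  continuous f.
Proof.
by move=> h x; apply/differentiable_continuous/derivable1_diffP; case: (h x).
Qed.

End RealCalculus.

(* Matching on the head symbol avoids failed unifications, which unfold [cos]
   and [expR]. *)
Ltac cts :=
  lazymatch goal with
  | |- continuous (fun x => x) => exact: cts_id
  | |- continuous (fun x => @Algebra.add _ (@?f x) (@Algebra.opp _ (@?g x))) =>
      apply: (@ctsB _ f g); cts
  | |- continuous (fun x => @Algebra.add _ (@?f x) (@?g x)) => apply: (@ctsD _ f g); cts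
  | |- continuous (fun x => @Algebra.opp _ (@?f x)) => apply: (@ctsN _ f); cts
  | |- continuous (fun x => @GRing.mul _ (@?f x) (@?g x)) => apply: (@ctsM _ f g); cts
  | |- continuous (fun x => @GRing.exp _ (@?f x) ?n) => apply: (@ctsX _ f n); cts
  | |- continuous (fun x => cos (@?f x)) => apply: (@cts_cos _ f); cts
  | |- continuous (fun x => sin (@?f x)) => apply: (@cts_sin _ f); cts
  | |- continuous (fun x => expR (@?f x)) => apply: (@cts_expR _ f); cts
  | |- continuous (fun x => `|@?f x|) => apply: (@cts_norm _ f); cts
  | |- continuous (fun _ => ?c) => exact: cst_continuous
  | _ => assumption
  end.

(** * Integration of continuous functions over the frequency band *)

Section BandIntegrals.
Context {R : realType}.
Local Notation mu := (@lebesgue_measure R).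
Local Notation band := (@band R).
Implicit Types (f g F p : R -> R) (x a b t r : R).

Lemma measurable_band : measurable band. Proof. exact: measurable_itv. Qed.

Lemma cts_itv_integrable f a b : continuous f ->
  mu.-integrable `[a, b] (EFin \o f).
Proof.
move=> cf; apply: continuous_compact_integrable; first exact: segment_compact.
exact: continuous_subspaceT.
Qed.

Lemma cts_band_integrable f : continuous f -> mu.-integrable band (EFin \o f).
Proof.
move=> cf; apply: integrableS (cts_itv_integrable (- 2^-1) (2^-1) cf) => //.
  exact: measurable_band.
by move=> x; rewrite /band/= !in_itv/= => /andP[/ltW -> /ltW ->].
Qed.

(** The endpoints are null; on the closed interval, compactness and the fundamental theorem of
    calculus are available. *)
Lemma band_itvE f : continuous f ->
  Rintegral mu band f = Rintegral mu `[- 2^-1, 2^-1] f.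
Proof.
move=> cf; rewrite Rintegral_itv_bndo_bndc; last exact: cts_band_integrable.
rewrite Rintegral_itv_obnd_cbnd//.
apply: integrableS (cts_itv_integrable (- 2^-1) (2^-1) cf) => //.
by move=> x/=; rewrite !in_itv/= => /andP[/ltW -> ->].
Qed.

Lemma FTC_itv f F a b : a <= b -> continuous f ->
  (forall x, is_derive x 1 F (f x)) ->
  Rintegral mu `[a, b] f = F b - F a.
Proof.
rewrite le_eqVlt => /predU1P[<- _ _|ab cf dF].
  by rewrite set_itv1 Rintegral_set1 subrr.
have cF := derive_continuous dF.
rewrite /Rintegral (continuous_FTC2 (F := F))//.
- exact: continuous_subspaceT.
- split.
  + by move=> x _; case: (dF x).
  + by apply: cvg_at_right_filter; exact: cF.
  + by apply: cvg_at_left_filter; exact: cF.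
- by move=> x _; rewrite derive1E; exact: derive_val.
Qed.

Lemma FTC_band f F : continuous f -> (forall x, is_derive x 1 F (f x)) ->
  Rintegral mu band f = F 2^-1 - F (- 2^-1).
Proof.
move=> cf dF; rewrite band_itvE// (FTC_itv _ cf dF)//.
by lra.
Qed.

(** The substitution [x -> - x] preserves the band and turns the integral into its own negative. *)
Lemma band_odd f : continuous f -> (forall x, f (- x) = - f x) ->
  Rintegral mu band f = 0.
Proof.
move=> cf fN; rewrite band_itvE//.
suff: Rintegral mu `[- 2^-1, 2^-1] f = - Rintegral mu `[- 2^-1, 2^-1] f.
  by set r := Rintegral _ _ _ => /eqP; rewrite -addr_eq0 -mulr2n mulrn_eq0/= => /eqP.
have e : Rintegral mu `[- 2^-1, 2^-1] f = Rintegral mu `[- 2^-1, 2^-1] (f \o -%R).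
  have /(_ _ _)/(congr1 fine) := @integration_by_substitution_oppr _ f (- 2^-1) (2^-1).
  by rewrite opprK; apply; [lra|exact: continuous_subspaceT].
rewrite [LHS]e -[RHS]mulN1r -RintegralZl//; last exact: cts_itv_integrable.
by apply: eq_Rintegral => x _ /=; rewrite fN mulN1r.
Qed.

Lemma band_le f g : continuous f -> continuous g ->
  (forall x, band x -> f x <= g x) -> Rintegral mu band f <= Rintegral mu band g.
Proof.
move=> cf cg fg; apply: le_Rintegral => //;
  by [exact: measurable_band|exact: cts_band_integrable].
Qed.

Lemma measure_band : mu band = 1%E.
Proof.
apply: etrans (lebesgue_measure_itv _) _ => /=.
rewrite lte_fin ifT; last by lra.
by rewrite -EFinB; congr EFin; lra.
Qed.

Lemma band_cst r : Rintegral mu band (cst r) = r.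
Proof.
have := @Rintegral_cst _ _ R mu _ measurable_band r.
by have /(congr1 fine) /= -> := measure_band; rewrite mulr1.
Qed.

Lemma band_norm_le f r : continuous f -> (forall x, band x -> `|f x| <= r) ->
  `|Rintegral mu band f| <= r.
Proof.
move=> cf h; apply: (@le_trans _ _ (Rintegral mu band (fun x => `|f x|))).
  apply: le_normr_Rintegral; first exact: measurable_band.
  exact: cts_band_integrable.
rewrite -[leRHS]band_cst; apply: band_le => //.
- by cts.
- exact: cst_continuous.
Qed.

End BandIntegrals.

(** * Cosine transforms and the action of B and its powers on symbols *)

Section CosineTransform.
Context {R : realType}.
Local Notation mu := (@lebesgue_measure R).
Local Notation band := (@band R).
Implicit Types (p q : R -> R) (x a c t : R).

(** Differentiation under the integral sign. The majorant [G] does not depend on [t] and is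
    integrable because it is continuous and the band is bounded, so any window around [t] will do;
    the proof takes radius 1. *)
Lemma derive_band_integral (f df : R -> R -> R) (G : R -> R) :
  (forall t, continuous (f t)) -> continuous G ->
  (forall t x, is_derive t 1 (f ^~ x) (df t x)) ->
  (forall t x, `|df t x| <= G x) ->
  forall t, is_derive t 1 (fun t => Rintegral mu band (f t))
                          (Rintegral mu band (df t)).
Proof.
move=> cf cG ddf dfG t.
have tI : `]t - 1, t + 1[%classic t by rewrite /= in_itv/=; apply/andP; split; lra.
have G0 y : 0 <= G y by apply: le_trans (dfG 0 y).
have d1 s x : partial1of2 f s x = df s x.
  by rewrite partial1of2E; have [_ ->] := ddf s x.
have h1 x : `]t - 1, t + 1[%classic x -> mu.-integrable band (EFin \o f x).
  by move=> _; exact: cts_band_integrable.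
have h2 x y : `]t - 1, t + 1[%classic x -> band y -> derivable (f ^~ y) x 1.
  by move=> _ _; have [] := ddf x y.
have h3 x y : `]t - 1, t + 1[%classic x -> band y -> `|partial1of2 f x y| <= G y.
  by move=> _ _; rewrite d1.
have iG := cts_band_integrable cG.
apply: DeriveDef.
  exact: (@derivable_under_integral R _ _ mu f band measurable_band t (t - 1) (t + 1)
    tI h1 h2 G G0 iG h3).
rewrite -derive1E (@differentiation_under_integral R _ _ mu f band measurable_band t (t - 1) (t + 1)
    tI h1 h2 G G0 iG h3).
by apply: eq_Rintegral => x _; rewrite d1.
Qed.

Definition cosint p t : R := Rintegral mu band (fun x => cos (2 * pi * x * t) * p x).

Lemma cts_cosint_integrand p t : continuous p ->
  continuous (fun x => cos (2 * pi * x * t) * p x).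
Proof. by move=> cp; cts. Qed.

Lemma cosintD p q t : continuous p -> continuous q ->
  cosint (fun x => p x + q x) t = cosint p t + cosint q t.
Proof.
move=> cp cq; rewrite /cosint.
rewrite -RintegralD; [|exact: measurable_band|apply: cts_band_integrable; cts..].
by apply: eq_Rintegral => x _; rewrite mulrDr.
Qed.

Lemma cosintZ c p t : continuous p -> cosint (fun x => c * p x) t = c * cosint p t.
Proof.
move=> cp; rewrite /cosint.
rewrite -RintegralZl; [|exact: measurable_band|apply: cts_band_integrable; cts].
by apply: eq_Rintegral => x _; rewrite mulrCA.
Qed.

Lemma cosint_sum (F : nat -> R -> R) n t : (forall k, continuous (F k)) ->
  cosint (fun x => \sum_(k < n) F k x) t = \sum_(k < n) cosint (F k) t.
Proof.
move=> cF; elim: n => [|n IH].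
  rewrite big_ord0; under [X in cosint X]eq_fun do rewrite big_ord0.
  by have := cosintZ 0 t (@cst_continuous R R 0); under eq_fun do rewrite mul0r; rewrite mul0r.
rewrite big_ord_recr/= -IH -cosintD//; last by apply: cts_sum.
by under eq_fun do rewrite big_ord_recr.
Qed.

(** Since [|sin| <= 1], the differentiated integrand is dominated by [|2 pi x p(x)|], uniformly in
    [t]. *)
Lemma derive_cosint p a t : continuous p ->
  is_derive t 1 (fun t => cosint p (t - a))
    (Rintegral mu band (fun x => - sin (2 * pi * x * (t - a)) * (2 * pi * x * p x))).
Proof.
move=> cp.
pose f s x := cos (2 * pi * x * (s - a)) * p x.
pose df s x := - sin (2 * pi * x * (s - a)) * (2 * pi * x * p x).
apply: (@derive_band_integral f df (fun x => `|2 * pi * x * p x|)).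
- by move=> s; rewrite /f; cts.
- by cts.
- move=> s x; rewrite /f /df.
  by apply: is_derive_eq; rewrite /GRing.scale/=; ring.
- move=> s x; rewrite /df normrM ler_piMl// normrN.
  exact: sin_max.
Qed.

Lemma derive2_cosint p a t : continuous p ->
  is_derive t 1
    (fun t => Rintegral mu band (fun x => - sin (2 * pi * x * (t - a)) * (2 * pi * x * p x)))
    (cosint (fun x => - (2 * pi * x) ^+ 2 * p x) (t - a)).
Proof.
move=> cp.
pose f s x := - sin (2 * pi * x * (s - a)) * (2 * pi * x * p x).
pose df s x := cos (2 * pi * x * (s - a)) * (- (2 * pi * x) ^+ 2 * p x).
apply: (@derive_band_integral f df (fun x => `|(2 * pi * x) ^+ 2 * p x|)).
- by move=> s; rewrite /f; cts.
- by cts.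
- move=> s x; rewrite /f /df.
  by apply: is_derive_eq; rewrite /GRing.scale/=; ring.
- move=> s x; rewrite /df normrM mulNr normrN ler_piMl//.
  exact: cos_max.
Qed.

(* The function of BL whose symbol is [x |-> exp (- 2 i pi a x) p(x)], for [p]
   real and even: the sine part of its Fourier integral vanishes. *)
Definition cosT a p : R -> R[i] := fun t => (cosint p (t - a))%:C%C.

Lemma cderive_real (f : R -> R) :
  cderive (fun t => (f t)%:C%C) = (fun t => (derive1 f t)%:C%C).
Proof.
apply/funext => t; rewrite /cderive.
by rewrite [im_fun _](_ : _ = cst 0)// (derive1E (cst 0)) derive_cst.
Qed.

(** Differentiating [cos (2 pi x (t - a))] twice in [t] brings out the factor [- (2 pi x)^2], which
    is absorbed into the symbol. *)
Lemma opB_cosT a p : continuous p ->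
  opB (cosT a p) = cosT a (fun x => - (2 * pi * x) ^+ 2 * p x).
Proof.
move=> cp; rewrite /opB /cosT !cderive_real; apply/funext => t.
rewrite [X in derive1 X](_ : _ = fun t => Rintegral mu band
  (fun x => - sin (2 * pi * x * (t - a)) * (2 * pi * x * p x))).
  by rewrite derive1E; have [_ ->] := derive2_cosint a t cp.
by apply/funext => s; rewrite derive1E; have [_ ->] := derive_cosint a s cp.
Qed.

(** The operator that is exponentiated in [opA d], named so that its iterates can be rewritten. *)
Definition scaledB (d : R) : (R -> R[i]) -> R -> R[i] := fun u t => d%:C%C * opB u t.

Lemma scaledB_cosT d a p : continuous p ->
  scaledB d (cosT a p) = cosT a (fun x => - (d * (2 * pi) ^+ 2 * x ^+ 2) * p x).
Proof.
move=> cp; apply/funext => t; rewrite /scaledB opB_cosT// /cosT -rmorphM/=.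
rewrite -cosintZ//; last by cts.
by congr (cosint _ _)%:C%C; apply/funext => x; ring.
Qed.

Lemma iter_scaledB_cosT d a p n : continuous p ->
  iter n (scaledB d) (cosT a p) =
  cosT a (fun x => (- (d * (2 * pi) ^+ 2 * x ^+ 2)) ^+ n * p x).
Proof.
move=> cp; elim: n => [|n IH].
  by congr (cosT _ _); apply/funext => x; rewrite expr0 mul1r.
rewrite iterS IH scaledB_cosT; last by cts.
by apply: (congr1 (cosT a)); apply/funext => x; rewrite [_ ^+ n.+1]exprS -[RHS]mulrA.
Qed.

(** Taylor polynomial of exp with [n] terms, hence of degree [n - 1], indexed like
    [exp_partial_sum]. *)
Definition expsum n (y : R) : R := \sum_(k < n) (k`!%:R)^-1 * y ^+ k.

Lemma exp_partial_sum_cosT d a p n : continuous p ->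
  exp_partial_sum (scaledB d) (cosT a p) n =
  cosT a (fun x => expsum n (- (d * (2 * pi) ^+ 2 * x ^+ 2)) * p x).
Proof.
move=> cp; apply/funext => t; rewrite /exp_partial_sum [RHS]/cosT /expsum.
under [X in _ = (cosint X _)%:C%C]eq_fun do rewrite mulr_suml.
rewrite (cosint_sum (F := fun k x => (k`!%:R)^-1 * (- (d * (2 * pi) ^+ 2 * x ^+ 2)) ^+ k * p x)).
  rewrite rmorph_sum; apply: eq_bigr => k _; rewrite iter_scaledB_cosT//.
  rewrite -(rmorph_nat (real_complex R)) -fmorphV -rmorphM/=; congr (_ %:C)%C.
  rewrite -cosintZ; last by cts.
  by congr (cosint _ _); apply/funext => x; rewrite mulrA.
by move=> k; cts.
Qed.

End CosineTransform.

(** * Decay of cosine transforms, tails of the exponential series, and an integrable weight *)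

Section Decay.
Context {R : realType}.
Local Notation mu := (@lebesgue_measure R).
Local Notation band := (@band R).
Implicit Types (p q f : R -> R) (x y a c t K M : R).

Lemma band_normE x : (`|x| < 2^-1) = `[< band x >].
Proof.
by apply/idP/asboolP; rewrite /Defs.band/= in_itv/= ltr_norml.
Qed.

Lemma cosint_le p K t : continuous p -> (forall x, `|x| <= 2^-1 -> `|p x| <= K) ->
  `|cosint p t| <= K.
Proof.
move=> cp pK; apply: band_norm_le; first exact: cts_cosint_integrand.
move=> x bx; rewrite normrM; apply: le_trans (pK x _).
  by rewrite ler_piMl// cos_max.
by apply: ltW; rewrite band_normE; apply/asboolP.
Qed.

(* Integrate the derivative of [sin (2 pi x t) p(x)] over the band. *)
Lemma cosint_decay p dp K t : continuous dp ->
  (forall x, is_derive x 1 p (dp x)) ->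
  (forall x, `|x| <= 2^-1 -> `|p x| <= K) ->
  (forall x, `|x| <= 2^-1 -> `|dp x| <= K) ->
  (cosint p t) ^+ 2 * (1 + t ^+ 2) <= 2 * K ^+ 2.
Proof.
move=> cdp ddp pK dpK; have cp := derive_continuous ddp.
have f1 := cosint_le t cp pK.
have K0 : 0 <= K by apply: le_trans (pK 0 _) => //; rewrite normr0 invr_ge0.
pose S x := sin (2 * pi * x * t) * p x.
have dS x : is_derive x 1 S (2 * pi * t * (cos (2 * pi * x * t) * p x)
                             + sin (2 * pi * x * t) * dp x).
  by apply: is_derive_eq; rewrite /GRing.scale/=; ring.
have c1 : continuous (fun x => 2 * pi * t * (cos (2 * pi * x * t) * p x)) by cts.
have c2 : continuous (fun x => sin (2 * pi * x * t) * dp x) by cts.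
have := FTC_band (ctsD c1 c2) dS.
rewrite RintegralD; [|exact: measurable_band|exact: cts_band_integrable..].
rewrite RintegralZl; [|exact: measurable_band|by apply: cts_band_integrable; cts].
rewrite -/(cosint p t); set J := Rintegral mu band _ => e.
have J1 : `|J| <= K.
  apply: band_norm_le => // x bx; rewrite normrM.
  apply: le_trans (dpK x _); first by rewrite ler_piMl// sin_max.
  by apply: ltW; rewrite band_normE; apply/asboolP.
have Sb x : `|x| <= 2^-1 -> `|S x| <= K.
  move=> xb; rewrite normrM; apply: le_trans (pK x xb).
  by rewrite ler_piMl// sin_max.
have S1 : `|S 2^-1| <= K by apply: Sb; rewrite ger0_norm// invr_ge0.
have S2 : `|S (- 2^-1)| <= K by apply: Sb; rewrite normrN ger0_norm// invr_ge0.
have tf : `|t * cosint p t| <= K.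
  (* The identity [e] writes [2 pi t cosint p t] as two boundary values minus [J], three terms of
     size at most [K], while [2 pi >= 4]. *)
  have h : 4 * `|t * cosint p t| <= 3 * K.
    apply: (@le_trans _ _ `|2 * pi * t * cosint p t|).
      rewrite -mulrA !normrM ler_wpM2r ?mulr_ge0//.
      by rewrite !ger0_norm ?pi_ge0//; have := pi_ge2 R; lra.
    have -> : 2 * pi * t * cosint p t = S 2^-1 - S (- 2^-1) - J by rewrite -e addrK.
    apply: le_trans (ler_normB _ _) _.
    have := ler_normB (S 2^-1) (S (- 2^-1)).
    by move: S1 S2 J1; lra.
  by move: h; have := normr_ge0 (t * cosint p t); lra.
rewrite mulrDr mulr1 -exprMn (mulrC (cosint p t)) mulr2n mulrDl mul1r.
by apply: lerD; rewrite -ler_sqrt ?sqr_ge0// !sqrtr_sqr (ger0_norm K0).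
Qed.

Lemma expsum_cvg y : expsum n y @[n --> \oo] --> expR y.
Proof.
have := is_cvg_series_exp_coeff y; rewrite /expR.
rewrite (_ : series _ = expsum ^~ y)//; apply/funext => n.
by rewrite /series/= /expsum big_mkord; apply: eq_bigr => k _; rewrite mulrC.
Qed.

(** Termwise, the tail of the series at [y] is dominated by its tail at [M]; this is shown for
    finite partial sums, then passed to the limit. The bound is uniform in [y], as needed for the
    convergence of symbols over the whole band. *)
Lemma expsum_dist M y n : `|y| <= M ->
  `|expsum n y - expR y| <= expR M - expsum n M.
Proof.
move=> yM; have M0 : 0 <= M by apply: le_trans yM.
have h m : (n <= m)%N -> `|expsum n y - expsum m y| <= expR M - expsum n M.
  move=> /subnKC <-; set j := (m - n)%N; clearbody j => {m}.
  apply: (@le_trans _ _ (expsum (n + j) M - expsum n M)).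
    rewrite /expsum !big_split_ord/= opprD addNKr normrN [leRHS]addrC addKr.
    apply: le_trans (ler_norm_sum _ _ _) _; apply: ler_sum => k _.
    rewrite normrM normrX normfV normr_nat ler_wpM2l ?invr_ge0//.
    by rewrite lerXn2r// nnegrE.
  rewrite lerD2r; apply: (cvgr_to_ge (@expsum_cvg M)).
  near=> q; rewrite /expsum.
  have /subnKC <- : (n + j <= q)%N by near: q; exact: nbhs_infty_ge.
  rewrite [leRHS]big_split_ord/= lerDl sumr_ge0// => k _.
  by rewrite mulr_ge0 ?invr_ge0// exprn_ge0.
have hc : `|expsum n y - expsum m y| @[m --> \oo] --> `|expsum n y - expR y|.
  by apply: cvg_norm; apply: cvgB; [exact: cvg_cst|exact: expsum_cvg].
apply: (cvgr_to_le hc); near=> m; apply: h.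
by near: m; exact: nbhs_infty_ge.
Unshelve. all: end_near. Qed.

Lemma expsum_succ n y : expsum n.+1 y = expsum n y + (n`!%:R)^-1 * y ^+ n.
Proof. by rewrite /expsum big_ord_recr. Qed.

Lemma derive_expsum n y : is_derive y 1 (expsum n.+1) (expsum n y).
Proof.
elim: n y => [|n IH] y.
  rewrite (_ : expsum 1 = cst 1); last first.
    by apply/funext => z; rewrite /expsum big_ord1 fact0 invr1 mul1r expr0.
  by apply: is_derive_eq; rewrite /expsum big_ord0.
rewrite (_ : expsum n.+2 = fun z => expsum n.+1 z + ((n.+1)`!%:R)^-1 * z ^+ n.+1); last first.
  by apply/funext => z; rewrite expsum_succ.
have dX : is_derive y 1 (fun z : R => z ^+ n.+1) (n.+1%:R * y ^+ n).
  have := is_deriveX n.+1 (is_derive_id y (1 : R)).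
  rewrite (_ : id ^+ n.+1 = fun z : R => z ^+ n.+1); last by apply/funext => z; rewrite exprfctE.
  by move=> d; apply: is_derive_eq; rewrite /GRing.scale/= mulr1.
apply: is_derive_eq.
rewrite expsum_succ /GRing.scale/=; congr +%R.
by rewrite factS natrM invfM mulrACA mulVf ?mul1r// pnatr_eq0.
Qed.

Lemma cts_expsum n f : continuous f -> continuous (fun x : R => expsum n (f x) : R).
Proof.
by move=> cf; apply: (@cts_sum _ (fun k x => (k`!%:R)^-1 * f x ^+ k)) => k; cts.
Qed.

(** The unnormalised Cauchy density centred at [a], used as integrable majorant on the line. *)
Definition cauchyw a t : R := (1 + (t - a) ^+ 2)^-1.

Lemma oneDsq_gt0 a : 0 < 1 + a ^+ 2.
Proof. by rewrite ltr_wpDr// sqr_ge0. Qed.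

Lemma cauchyw_ge0 a t : 0 <= cauchyw a t.
Proof. by rewrite invr_ge0 ltW// oneDsq_gt0. Qed.

Lemma cts_cauchyw a : continuous (cauchyw a).
Proof.
move=> t; apply: cvgV; first by rewrite gt_eqF// oneDsq_gt0.
have : continuous (fun t => 1 + (t - a) ^+ 2) by cts.
exact.
Qed.

Lemma integrable_cauchyw a : mu.-integrable setT (EFin \o cauchyw a).
Proof.
have i0 : mu.-integrable setT (EFin \o cauchyw 0).
  apply/integrableP; split.
    by apply/measurable_EFinP; apply: continuous_measurable_fun; exact: cts_cauchyw.
  under eq_integral => t _ do rewrite /= ger0_norm ?cauchyw_ge0//.
  rewrite ge0_symfun_integralT; [|exact: cauchyw_ge0|exact: cts_cauchyw|]; last first.
    by move=> t; rewrite /cauchyw/= !subr0 sqrrN.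
  rewrite -set_itvcy.
  under eq_integral => t _ do rewrite /cauchyw subr0.
  by rewrite integral0y_oneDsqr -EFinM ltry.
(* The case of a general centre follows by comparison: [1 + t^2 <= 2 (1 + a^2) (1 + (t - a)^2)],
   because [2 a^2 + 2 (t - a)^2 - t^2 = (t - 2 a)^2]. *)
have i1 : mu.-integrable setT (fun t => ((2 * (1 + a ^+ 2))%:E * (EFin \o cauchyw 0) t)%E).
  exact: integrableZl.
apply: le_integrable i1 => //.
  by apply/measurable_EFinP; apply: continuous_measurable_fun; exact: cts_cauchyw.
move=> t _ /=; rewrite lee_fin ger0_norm ?cauchyw_ge0// ger0_norm; last first.
  by rewrite !mulr_ge0 ?cauchyw_ge0// ltW// oneDsq_gt0.
rewrite /cauchyw subr0 ler_pdivlMr ?oneDsq_gt0// mulrC ler_pdivrMr ?oneDsq_gt0//.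
by have := sqr_ge0 (t - 2 * a); have := sqr_ge0 (a * (t - a)); lra.
Qed.

End Decay.

(** * Membership in BL, continuity of its elements, and the squared norm *)

Section BandLimitedFunctions.
Context {R : realType}.
Local Notation mu := (@lebesgue_measure R).
Local Notation band := (@band R).
Implicit Types (p q : R -> R) (f g u : R -> R[i]) (x a c t K : R).

Lemma modulus_sq (z : R[i]) : modulus z ^+ 2 = complex.Re z ^+ 2 + complex.Im z ^+ 2.
Proof.
by case: z => r s; rewrite /modulus /= sqr_sqrtr// addr_ge0 ?sqr_ge0.
Qed.

Lemma modulus_real (r : R) : modulus (r%:C)%C = `|r|.
Proof. by rewrite /modulus/= expr0n/= addr0 sqrtr_sqr. Qed.

(** The symbol [exp (- 2 i pi a x) p(x)] has modulus [|p(x)|], so it is square integrable; evenness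
    of [p] makes the imaginary part of the Fourier integrand odd. *)
Lemma BL_cosT a p : continuous p -> (forall x, p (- x) = p x) -> BL (cosT a p).
Proof.
move=> cp ep.
pose phi x : R[i] := (cos (2 * pi * x * a) * p x +i* - (sin (2 * pi * x * a) * p x))%C.
have cre : continuous (re_fun phi) by rewrite /re_fun /=; cts.
have cim : continuous (im_fun phi) by rewrite /im_fun /=; cts.
exists phi.
  split.
  - by apply: (measurable_funS measurableT) => //; exact: continuous_measurable_fun.
  - by apply: (measurable_funS measurableT) => //; exact: continuous_measurable_fun.
  - have : mu.-integrable band (EFin \o (fun x => p x ^+ 2)).
      by apply: cts_band_integrable; cts.
    move=> /integrableP[_]; congr (_ < _)%E.
    apply: eq_integral => x _; rewrite modulus_sq /=; congr EFin.
    by rewrite ger0_norm ?sqr_ge0// sqrrN !exprMn -mulrDl cos2Dsin2 mul1r.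
move=> t; rewrite /cosT /cintegral; congr (_ +i* _)%C.
  apply: eq_Rintegral => x _; rewrite /re_fun/= mulrN opprK.
  by rewrite mulrBr cosB; ring.
rewrite -[LHS](@band_odd _ (fun x => sin (2 * pi * x * (t - a)) * p x)).
- apply: eq_Rintegral => x _; rewrite /im_fun/= mulrN.
  by rewrite mulrBr sinB; ring.
- by cts.
- by move=> x; rewrite ep mulrN !mulNr sinN mulNr.
Qed.

(** On a set of finite measure L^2 is contained in L^1: [|r| <= 1 + r^2 + s^2]. *)
Lemma L2_band_integrable phi : L2_band phi ->
  mu.-integrable band (EFin \o re_fun phi) /\ mu.-integrable band (EFin \o im_fun phi).
Proof.
move=> [mre mim fin].
have mm : measurable_fun band (fun x => modulus (phi x) ^+ 2).
  under eq_fun do rewrite modulus_sq.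
  by apply: measurable_funD; exact: measurable_funX.
have i2 : mu.-integrable band (EFin \o (fun x => 1 + modulus (phi x) ^+ 2)).
  have i1 : mu.-integrable band (EFin \o cst (1 : R)).
    by apply: cts_band_integrable; exact: cst_continuous.
  have i3 : mu.-integrable band (EFin \o (fun x => modulus (phi x) ^+ 2)).
    apply/integrableP; split; first exact/measurable_EFinP.
    by under eq_integral => x _ do rewrite /= ger0_norm ?sqr_ge0//.
  exact: (@integrableD _ _ _ mu _ measurable_band _ _ i1 i3).
have aux (r s : R) : `|r| <= `|1 + (r ^+ 2 + s ^+ 2)|.
  rewrite [leRHS]ger0_norm ?addr_ge0 ?sqr_ge0//.
  have := sqr_ge0 (`|r| - 1); rewrite sqrrB1 real_normK ?num_real// => h.
  by have := normr_ge0 r; have := sqr_ge0 s; lra.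
split; apply: le_integrable i2; rewrite ?/comp; try exact: measurable_band.
- exact/measurable_EFinP.
- by move=> x _ /=; rewrite lee_fin modulus_sq aux.
- exact/measurable_EFinP.
- by move=> x _ /=; rewrite lee_fin modulus_sq [_ ^+ 2 + _]addrC aux.
Qed.

(** Dominated convergence, with the majorant [|h| + |k|] independent of [t]. *)
Lemma cts_trig_integral (h k : R -> R) :
  mu.-integrable band (EFin \o h) -> mu.-integrable band (EFin \o k) ->
  continuous (fun t => Rintegral mu band
    (fun x => cos (2 * pi * x * t) * h x + sin (2 * pi * x * t) * k x)).
Proof.
move=> ih ik t.
have mtrig s : measurable_fun band (fun x => cos (2 * pi * x * s) : R) /\
               measurable_fun band (fun x => sin (2 * pi * x * s) : R).
  by split; apply: (measurable_funS measurableT) => //;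
    apply: continuous_measurable_fun; cts.
have mh : measurable_fun band h by move/integrableP : ih => [/measurable_EFinP].
have mk : measurable_fun band k by move/integrableP : ik => [/measurable_EFinP].
have iG : mu.-integrable band (EFin \o (fun x => `|h x| + `|k x|)).
  exact: (@integrableD _ _ _ mu _ measurable_band _ _ (integrable_abse ih) (integrable_abse ik)).
have bnd s x : `|cos (2 * pi * x * s) * h x + sin (2 * pi * x * s) * k x| <= `|h x| + `|k x|.
  apply: le_trans (ler_normD _ _) _; rewrite !normrM; apply: lerD.
    by rewrite ler_piMl// cos_max.
  by rewrite ler_piMl// sin_max.
have tI : t \in `]t - 1, t + 1[%classic.
  by rewrite inE/= in_itv/=; apply/andP; split; lra.
apply: (@continuity_under_integral R _ _ mu
  (fun s x => cos (2 * pi * x * s) * h x + sin (2 * pi * x * s) * k x)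
  band measurable_band (t - 1) (t + 1) _ _ (fun x => `|h x| + `|k x|) iG _ t tI).
- move=> s _; apply: le_integrable iG; first exact: measurable_band.
    by apply/measurable_EFinP; apply: measurable_funD; apply: measurable_funM => //;
      case: (mtrig s).
  move=> x _ /=; rewrite lee_fin [leRHS]ger0_norm ?addr_ge0//.
- apply: aeW => x _ s _.
  have : continuous (fun s => cos (2 * pi * x * s) * h x + sin (2 * pi * x * s) * k x) by cts.
  exact.
- by move=> s _; apply: aeW => x _; exact: bnd.
Qed.

Lemma BL_continuous g : BL g -> continuous (re_fun g) /\ continuous (im_fun g).
Proof.
move=> [phi /L2_band_integrable[ire iim] gE].
have nim : mu.-integrable band (EFin \o (fun x => - im_fun phi x)).
  exact: (integrableN iim).
split.
- rewrite (_ : re_fun g = fun t => Rintegral mu band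
    (fun x => cos (2 * pi * x * t) * re_fun phi x + sin (2 * pi * x * t) * - im_fun phi x)).
    exact: cts_trig_integral.
  apply/funext => t; rewrite /re_fun gE/=; apply: eq_Rintegral => x _.
  by rewrite /re_fun /im_fun; case: (phi x) => r s /=; ring.
- rewrite (_ : im_fun g = fun t => Rintegral mu band
    (fun x => cos (2 * pi * x * t) * im_fun phi x + sin (2 * pi * x * t) * re_fun phi x)).
    exact: cts_trig_integral.
  apply/funext => t; rewrite /im_fun gE/=; apply: eq_Rintegral => x _.
  by rewrite /re_fun /im_fun; case: (phi x) => r s /=; ring.
Qed.

Lemma L2norm_sq f : (L2norm f ^+ 2 = \int[mu]_t (modulus (f t) ^+ 2)%:E)%E.
Proof.
rewrite /L2norm.
have pe (e : \bar R) : (0 <= e -> e ^+ 2 = e `^ 2 :> \bar R)%E.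
  case: e => [r| |]//; rewrite ?lee_fin => r0.
    by rewrite /= powR_mulrn.
  by rewrite /= gt_eqF.
rewrite pe ?Lnorm_ge0// poweR_Lnorm//; apply: eq_integral => t _ /=.
by rewrite powR_mulrn// real_normK ?num_real.
Qed.

(** If [h t > 0], then [h] exceeds [h t / 2] on an interval of length [2 e] around [t], and the
    integral is at least [e * h t > 0]. *)
Lemma integral_eq0_cts (h : R -> R) : continuous h -> (forall t, 0 <= h t) ->
  (\int[mu]_t (h t)%:E = 0)%E -> h =1 cst 0.
Proof.
move=> ch h0 int0 t; apply/eqP; rewrite eq_le h0 andbT leNgt; apply/negP => ht.
have [e /= e0 he] : \forall s \near t, h t / 2 < h s.
  by apply: (cvgr_gt (h t) (ch t)); rewrite ltr_pdivrMr// ltr_pMr// ltr1n.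
pose I := `]t - e, t + e[%classic.
have mI : measurable I by exact: measurable_itv.
suff : (0 < \int[mu]_s (h s)%:E)%E by rewrite int0 ltxx.
apply: (@lt_le_trans _ _ (\int[mu]_(s in I) (h t / 2)%:E)%E).
  rewrite integral_cst// [X in (_ * X)%E](_ : _ = (2 * e)%:E).
    by rewrite -EFinM lte_fin !mulr_gt0// invr_gt0.
  apply: etrans (lebesgue_measure_itv _) _ => /=.
  rewrite lte_fin ifT; last by lra.
  by rewrite -EFinB; congr EFin; lra.
have mh : measurable_fun setT (EFin \o h).
  by apply/measurable_EFinP; exact: continuous_measurable_fun.
apply: (@le_trans _ _ (\int[mu]_(s in I) (h s)%:E)%E).
  apply: ge0_le_integral => //.
  - by move=> s _; rewrite lee_fin divr_ge0// ltW.
  - exact: (measurable_funS measurableT).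
  - move=> s; rewrite /I/= in_itv/= => /andP[s1 s2]; rewrite lee_fin; apply/ltW/he.
    by rewrite /= ltr_norml; apply/andP; split; lra.
by apply: ge0_subset_integral => //= s _; rewrite lee_fin.
Qed.

End BandLimitedFunctions.

(** * The operator A as multiplication of symbols by a Gaussian *)

Section OperatorA.
Context {R : realType}.
Local Notation mu := (@lebesgue_measure R).
Local Notation band := (@band R).
Implicit Types (p q : R -> R) (f g u : R -> R[i]) (x a c d t K : R).

Lemma lee_sqr_le (e : \bar R) K : (0 <= e)%E -> 0 <= K ->
  (e ^+ 2 <= (K ^+ 2)%:E)%E -> (e <= K%:E)%E.
Proof.
case: e => [r| |]//= r0 K0; rewrite ?lee_fin -?EFin_expe ?lee_fin.
by rewrite ler_sqr// nnegrE.
Qed.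

(** The pointwise decay [|f|^2 <= 2 K^2 cauchyw a] is integrated over the line. This replaces
    Plancherel's identity, at the price of also controlling the derivative of the symbol. *)
Lemma L2norm_cosT a p dp K : continuous dp ->
  (forall x, is_derive x 1 p (dp x)) ->
  (forall x, `|x| <= 2^-1 -> `|p x| <= K) ->
  (forall x, `|x| <= 2^-1 -> `|dp x| <= K) ->
  (L2norm (cosT a p) <= (K * Num.sqrt (2 * Rintegral mu setT (cauchyw a)))%:E)%E.
Proof.
move=> cdp ddp pK dpK; have cp := derive_continuous ddp.
have K0 : 0 <= K by apply: le_trans (pK 0 _) => //; rewrite normr0 invr_ge0.
have W0 : 0 <= Rintegral mu setT (cauchyw a).
  by apply: Rintegral_ge0 => t _; exact: cauchyw_ge0.
apply: lee_sqr_le; [exact: Lnorm_ge0|by rewrite mulr_ge0// sqrtr_ge0|].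
rewrite L2norm_sq exprMn sqr_sqrtr ?mulr_ge0// mulrA (mulrC (K ^+ 2)).
rewrite -RintegralZl//; last exact: integrable_cauchyw.
have iw : mu.-integrable setT (EFin \o (fun t => 2 * K ^+ 2 * cauchyw a t)).
  exact: (integrableZl measurableT _ (integrable_cauchyw a)).
rewrite /Rintegral fineK; last exact: (integrable_fin_num measurableT iw).
have ccos : continuous (fun t => cosint p (t - a)).
  by apply: derive_continuous => t; exact: derive_cosint.
apply: ge0_le_integral => //.
- by move=> t _; rewrite lee_fin sqr_ge0.
- apply/measurable_EFinP; apply: continuous_measurable_fun.
  have csq : continuous (fun t => `|cosint p (t - a)| ^+ 2) by cts.
  by under eq_fun do rewrite modulus_real; exact: csq.
- by move/integrableP : iw => [].
- move=> t _; rewrite lee_fin modulus_real real_normK ?num_real//.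
  rewrite ler_pdivlMr ?oneDsq_gt0//.
  exact: (cosint_decay _ cdp ddp).
Qed.

Lemma cosT_sub a p q : continuous p -> continuous q ->
  (fun t => cosT a p t - cosT a q t) = cosT a (fun x => p x - q x).
Proof.
move=> cp cq; apply/funext => t; rewrite /cosT -rmorphB/=; congr (_%:C)%C.
rewrite -[X in _ - X]mul1r -mulNr -cosintZ// -cosintD//; last by cts.
by congr (cosint _ _); apply/funext => x; rewrite mulN1r.
Qed.

(** The squared distance from [g1] to [g2] is at most twice the sum of their squared distances to
    [s n], hence zero in the limit; continuity then upgrades this to equality at every point. *)
Lemma BL_exp_uniq (s : nat -> R -> R[i]) g1 g2 : BL g1 -> BL g2 ->
  (forall n, continuous (re_fun (s n)) /\ continuous (im_fun (s n))) ->
  (fun n => L2norm (fun t => s n t - g1 t)) @ \oo --> (0 : \bar R) ->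
  (fun n => L2norm (fun t => s n t - g2 t)) @ \oo --> (0 : \bar R) ->
  g1 = g2.
Proof.
move=> /BL_continuous[cr1 ci1] /BL_continuous[cr2 ci2] cs s1 s2.
pose sq f t : R := modulus (f t) ^+ 2.
have csq f g : continuous (re_fun f) -> continuous (im_fun f) ->
    continuous (re_fun g) -> continuous (im_fun g) ->
    continuous (sq (fun t => f t - g t)).
  move=> crf cif crg cig.
  rewrite (_ : sq _ = fun t => (re_fun f t - re_fun g t) ^+ 2 + (im_fun f t - im_fun g t) ^+ 2).
    by cts.
  apply/funext => t; rewrite /sq modulus_sq /re_fun /im_fun.
  by case: (f t) => ? ?; case: (g t).
pose D := (\int[mu]_t (sq (fun t => g1 t - g2 t) t)%:E)%E.
have D0 : (0 <= D)%E by apply: integral_ge0 => t _; rewrite lee_fin sqr_ge0.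
have msq f g : continuous (re_fun f) -> continuous (im_fun f) ->
    continuous (re_fun g) -> continuous (im_fun g) ->
    measurable_fun setT (fun t => (sq (fun t => f t - g t) t)%:E).
  move=> *; apply/measurable_EFinP; apply: continuous_measurable_fun; exact: csq.
have DL n : (D <= 2%:E * L2norm (fun t => (s n t - g1 t)%R) ^+ 2 +
                  2%:E * L2norm (fun t => (s n t - g2 t)%R) ^+ 2)%E.
  have [crs cis] := cs n.
  rewrite !L2norm_sq.
  rewrite -!ge0_integralZl_EFin//; try (by move=> t _; rewrite lee_fin sqr_ge0);
    try (exact: msq).
  rewrite -ge0_integralD//; try (by move=> t _; rewrite -EFinM lee_fin mulr_ge0// sqr_ge0);
    try (by apply: measurable_funeM; exact: msq).
  apply: ge0_le_integral => //.
  - by move=> t _; rewrite lee_fin sqr_ge0.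
  - exact: msq.
  - by apply: emeasurable_funD; apply: measurable_funeM; exact: msq.
  - move=> t _; rewrite -!EFinM -EFinD lee_fin /sq !modulus_sq.
    case: (s n t) => r1 r2; case: (g1 t) => a1 b1; case: (g2 t) => a2 b2 /=.
    (* The slack in [(a - b)^2 <= 2 (r - a)^2 + 2 (r - b)^2] is the square [(2 r - a - b)^2]. *)
    have h1 := sqr_ge0 (2 * r1 - a1 - a2).
    have h2 := sqr_ge0 (2 * r2 - b1 - b2).
    by move: h1 h2; lra.
have De (e : R) : 0 < e -> (D <= (4 * e ^+ 2)%:E)%E.
  move=> e0.
  have near_small (v : nat -> \bar R) : v @ \oo --> (0 : \bar R) -> \forall n \near \oo, (v n < e%:E)%E.
    move=> cv; apply: (cv [set x | (x < e%:E)%E]); apply: open_nbhs_nbhs; split; first exact: open_ereal_lt_ereal.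
    by rewrite /= lte_fin.
  have := near_small _ s1; have := near_small _ s2 => h2 h1.
  near \oo => n.
  have e1 : (L2norm (fun t => s n t - g1 t)%R < e%:E)%E by near: n.
  have e2 : (L2norm (fun t => s n t - g2 t)%R < e%:E)%E by near: n.
  have sqle (v : \bar R) : (0 <= v)%E -> (v < e%:E)%E -> (v ^+ 2 <= (e ^+ 2)%:E)%E.
    case: v => [r| |]// r0; rewrite -EFin_expe lee_fin !(lee_fin,lte_fin) in r0 * => re.
    by rewrite ler_sqr ?nnegrE// ltW.
  apply: le_trans (DL n) _.
  have -> : ((4 * e ^+ 2)%:E = 2%:E * (e ^+ 2)%:E + 2%:E * (e ^+ 2)%:E)%E.
    by rewrite -!EFinM -EFinD; congr EFin; lra.
  apply: leeD; apply: lee_wpmul2l => //;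
    by apply: sqle => //; exact: Lnorm_ge0.
have Dz : D = 0%E.
  apply/eqP; rewrite eq_le D0 andbT; apply/lee_addgt0Pr => e e0; rewrite add0e.
  have h : 0 < Num.sqrt (e / 4) by rewrite sqrtr_gt0 divr_gt0.
  have e4 : 0 <= e / 4 by lra.
  apply: le_trans (De _ h) _; rewrite sqr_sqrtr//.
  by rewrite lee_fin; lra.
have z : sq (fun t => g1 t - g2 t) =1 cst 0.
  apply: integral_eq0_cts => //; first exact: csq.
  by move=> t; exact: sqr_ge0.
apply/funext => t; apply/eqP; rewrite -subr_eq0; apply/eqP.
have /eqP := z t; rewrite /sq/= sqrf_eq0 => /eqP.
exact: ComplexField.Normc.eq0_normc.
Unshelve. all: end_near. Qed.

(** The partial sums have symbols [expsum n (- c x^2) * p x]. These and their derivatives converge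
    uniformly on the band, which by [L2norm_cosT] gives convergence in norm. *)
Lemma opA_cosT d a p dp K : 0 < d -> continuous dp ->
  (forall x, p (- x) = p x) ->
  (forall x, is_derive x 1 p (dp x)) ->
  (forall x, `|x| <= 2^-1 -> `|p x| <= K) ->
  (forall x, `|x| <= 2^-1 -> `|dp x| <= K) ->
  opA d (cosT a p) = cosT a (fun x => expR (- (d * (2 * pi) ^+ 2 * x ^+ 2)) * p x).
Proof.
move=> d0 cdp ep ddp pK dpK; have cp := derive_continuous ddp.
have K0 : 0 <= K by apply: le_trans (pK 0 _) => //; rewrite normr0 invr_ge0.
set c := d * (2 * pi) ^+ 2.
have c0 : 0 <= c by rewrite mulr_ge0 ?sqr_ge0// ltW.
set q := fun x => expR (- (c * x ^+ 2)) * p x.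
have cq : continuous q by rewrite /q; cts.
have BLq : BL (cosT a q) by apply: BL_cosT => // x; rewrite /q sqrrN ep.
have cS n : continuous (fun x => expsum n (- (c * x ^+ 2)) * p x).
  by apply: ctsM => //; apply: cts_expsum; cts.
pose s := exp_partial_sum (scaledB d) (cosT a p).
have sE n : s n = cosT a (fun x => expsum n (- (c * x ^+ 2)) * p x).
  exact: exp_partial_sum_cosT.
have cvs : (fun n => L2norm (fun t => s n t - cosT a q t)) @ \oo --> (0 : \bar R).
  (* The derivative of [expsum n.+1] is [expsum n], so the remainder of order [n] controls the
     partial sum of order [n + 1] together with its derivative. *)
  rewrite -(cvg_shiftn 1).
  (* In the product rule, differentiating the remainder costs a factor [|2 c x| <= c], and [p] and
     [dp] are bounded by [K]; hence [(1 + c) K]. *)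
  pose B n := (1 + c) * K * (expR c - expsum n c) * Num.sqrt (2 * Rintegral mu setT (cauchyw a)).
  apply: (@squeeze_cvge _ _ _ _ (cst 0%E) _ (EFin \o B) _ 0%E).
  - apply: nearW => n; rewrite Lnorm_ge0/= addn1 sE cosT_sub//.
    pose dq x := - (2 * c * x) * (expsum n (- (c * x ^+ 2)) - expR (- (c * x ^+ 2))) * p x
      + (expsum n.+1 (- (c * x ^+ 2)) - expR (- (c * x ^+ 2))) * dp x.
    have rho0 : 0 <= expR c - expsum n c.
      have : `|c| <= c by rewrite ger0_norm.
      by move=> /(@expsum_dist _ _ c n); apply: le_trans.
    have rhoS : expR c - expsum n.+1 c <= expR c - expsum n c.
      rewrite lerD2l lerN2 expsum_succ lerDl mulr_ge0 ?invr_ge0 ?exprn_ge0//.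
    have xc x : `|x| <= 2^-1 -> `|- (c * x ^+ 2)| <= c.
      move=> x1; rewrite normrN normrM ger0_norm// ler_piMr// normrX.
      by rewrite expr_le1//; apply: le_trans x1 _; rewrite invf_le1// ler1n.
    have rn x m : `|x| <= 2^-1 ->
        `|expsum m (- (c * x ^+ 2)) - expR (- (c * x ^+ 2))| <= expR c - expsum m c.
      by move=> x1; apply: expsum_dist; exact: xc.
    have rnS x : `|x| <= 2^-1 ->
        `|expsum n.+1 (- (c * x ^+ 2)) - expR (- (c * x ^+ 2))| <= expR c - expsum n c.
      by move=> x1; apply: le_trans (rn x n.+1 x1) rhoS.
    apply: (@L2norm_cosT a _ dq).
    + have := @cts_expsum R n; have := @cts_expsum R n.+1 => h1 h2.
      have g1 : continuous (fun x : R => expsum n (- (c * x ^+ 2))) by apply: h2; cts.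
      have g2 : continuous (fun x : R => expsum n.+1 (- (c * x ^+ 2))) by apply: h1; cts.
      by rewrite /dq; cts.
    + move=> x.
      have d1 : is_derive x 1 (fun y : R => - (c * y ^+ 2)) (- (2 * c * x)).
        by apply: is_derive_eq; rewrite /GRing.scale/=; ring.
      have d2 := derive_comp_val d1 (derive_expsum n (- (c * x ^+ 2))).
      have d3 := derive_comp_val d1 (is_derive_expR (- (c * x ^+ 2))).
      have d4 := deriveM_val (deriveB_val d2 d3) (ddp x).
      rewrite (_ : dq x = (- (2 * c * x) * expsum n (- (c * x ^+ 2)) -
         - (2 * c * x) * expR (- (c * x ^+ 2))) * p x +
         (expsum n.+1 (- (c * x ^+ 2)) - expR (- (c * x ^+ 2))) * dp x).
        rewrite (_ : (fun y : R => _) = fun y => (expsum n.+1 (- (c * y ^+ 2)) - expR (- (c * y ^+ 2))) * p y)//.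
        by apply/funext => y; rewrite mulrBl.
      by rewrite /dq -mulrBr.
    + move=> x x1; rewrite /q -mulrBl normrM mulrC -mulrA.
      apply: (@le_trans _ _ (K * (expR c - expsum n c))).
        by apply: ler_pM => //; [exact: pK|exact: rnS].
      by rewrite ler_peMl ?mulr_ge0// lerDl.
    + move=> x x1; apply: le_trans (ler_normD _ _) _.
      have -> : (1 + c) * K * (expR c - expsum n c) =
        c * (K * (expR c - expsum n c)) + K * (expR c - expsum n c) by ring.
      apply: lerD; last by rewrite normrM mulrC; apply: ler_pM => //; [exact: dpK|exact: rnS].
      rewrite -(mulrA (- (2 * c * x))) normrM; apply: ler_pM => //.
        have c20 : 0 <= 2 * c by lra.
        rewrite normrN normrM (ger0_norm c20).
        by have := ler_wpM2l c0 x1; lra.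
      by rewrite normrM mulrC; apply: ler_pM => //; [exact: pK|exact: rn].
  - exact: cvg_cst.
  - have : B n @[n --> \oo] --> (1 + c) * K * (expR c - expR c) * Num.sqrt (2 * Rintegral mu setT (cauchyw a)).
      apply: cvgM; last exact: cvg_cst.
      apply: cvgM; first exact: cvg_cst.
      apply: cvgB; [exact: cvg_cst|exact: expsum_cvg].
    by rewrite subrr mulr0 mul0r => hB; apply: cvg_EFin => //; exact: nearW.
(* The limit exists, so [xget] does not fall back on its default, and uniqueness identifies the
   chosen value. *)
apply: xget_unique => // g [BLg cvg_g].
apply: (BL_exp_uniq BLg BLq _ cvg_g cvs) => n.
rewrite (exp_partial_sum_cosT d a n cp); split.
  exact: derive_continuous (fun t => derive_cosint a t (cS n)).
exact: cst_continuous.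
Qed.

(* With [b = 4 pi^2 delta], the symbol of [A^k] applied to [sinc]. *)
Definition gauss (b : R) (k : nat) x : R := expR (- (k%:R * (b * x ^+ 2))).

Lemma cts_gauss b k : continuous (gauss b k).
Proof. by rewrite /gauss; cts. Qed.

(** The multiplier of A is itself [gauss b 1], and exponents add. On the band
    [|dg x| <= 2 k b |x| <= k b], so [1 + k b] bounds both the symbol and its derivative. *)
Lemma opA_cosT_gauss d a k : 0 < d ->
  opA d (cosT a (gauss (d * (2 * pi) ^+ 2) k)) = cosT a (gauss (d * (2 * pi) ^+ 2) k.+1).
Proof.
move=> d0; set b := d * (2 * pi) ^+ 2.
have b0 : 0 <= b by rewrite mulr_ge0 ?sqr_ge0// ltW.
pose dg x := - (2 * k%:R * b * x) * gauss b k x.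
have g1 x : `|gauss b k x| <= 1.
  by rewrite ger0_norm ?expR_ge0// -expR0 ler_expR oppr_le0 mulr_ge0// mulr_ge0// sqr_ge0.
have cdg : continuous dg by have cg := @cts_gauss b k; rewrite /dg; cts.
have eg x : gauss b k (- x) = gauss b k x by rewrite /gauss sqrrN.
have ddg x : is_derive x 1 (gauss b k) (dg x).
  have d1 : is_derive x 1 (fun y : R => - (k%:R * (b * y ^+ 2))) (- (2 * k%:R * b * x)).
    by apply: is_derive_eq; rewrite /GRing.scale/=; ring.
  exact: derive_comp_val d1 (is_derive_expR _).
have kb : 0 <= k%:R * b by rewrite mulr_ge0.
have gK x : `|x| <= 2^-1 -> `|gauss b k x| <= 1 + k%:R * b.
  by move=> _; apply: le_trans (g1 x) _; rewrite lerDl.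
have dgK x : `|x| <= 2^-1 -> `|dg x| <= 1 + k%:R * b.
  move=> x1; rewrite normrM; apply: (@le_trans _ _ (k%:R * b)); last by rewrite lerDr.
  apply: (@le_trans _ _ `|- (2 * k%:R * b * x)|); first by rewrite ler_piMr.
  rewrite normrN -(mulrA 2) normrM ger0_norm; last by rewrite mulr_ge0.
  by have := ler_wpM2l kb x1; lra.
rewrite (opA_cosT a d0 cdg eg ddg gK dgK).
apply: (congr1 (cosT a)); apply/funext => x.
by rewrite /gauss -expRD -opprD -/b -natr1 [in RHS]mulrDl mul1r addrC.
Qed.

End OperatorA.

(** * The sinc function and the Fejer kernel as cosine transforms *)

Section TestFunction.
Context {R : realType}.
Local Notation mu := (@lebesgue_measure R).
Local Notation band := (@band R).
Implicit Types (x a b t : R).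

Lemma cosint0 (p : R -> R) : cosint p 0 = Rintegral mu band p.
Proof.
by apply: eq_Rintegral => x _; rewrite mulr0 cos0 mul1r.
Qed.

(** [gauss b 0] is the constant 1, and sinc is the transform of the constant symbol 1 on the band;
    the antiderivative divides by [t], so [t = 0] is treated apart. *)
Lemma sinc_translateE (i : int) b : sinc_translate i = cosT i%:~R (gauss b 0).
Proof.
apply/funext => s; rewrite /sinc_translate /cosT; congr (_%:C)%C.
move: (s - i%:~R) => t; rewrite /sinc.
have g1 : gauss b 0 = cst 1 by apply/funext => x; rewrite /gauss mul0r oppr0 expR0.
rewrite g1; have [->|t0] := eqVneq t 0; first by rewrite cosint0 band_cst.
have pi0 : pi != 0 :> R by rewrite gt_eqF// pi_gt0.
have c1 : continuous (fun x => cos (2 * pi * x * t) * 1) by cts.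
have dF x : is_derive x 1 (fun x => (2 * pi * t)^-1 * sin (2 * pi * x * t)) (cos (2 * pi * x * t) * 1).
  apply: is_derive_eq; rewrite /GRing.scale/=.
  set z := cos _; move: z (pi : R) pi0 => z q q0.
  by field; rewrite t0 q0.
rewrite /cosint (FTC_band c1 dF).
have e : 2 * pi * 2^-1 * t = pi * t by field.
rewrite mulrN !mulNr e sinN mulrN opprK.
set z := sin _; move: z (pi : R) pi0 => z q q0.
by field; rewrite t0 q0.
Qed.

(* The symbol of the Fejer kernel. *)
Definition triangle x : R := 1 - 2 * `|x|.

Lemma cts_triangle : continuous triangle.
Proof. by rewrite /triangle; cts. Qed.

(** Cuts the band at the kink of [triangle], so that each half has a smooth antiderivative. *)
Lemma band_split (f : R -> R) : continuous f ->
  Rintegral mu band f = Rintegral mu `[- 2^-1, 0] f + Rintegral mu `[0, 2^-1] f.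
Proof.
move=> cf; rewrite band_itvE//.
have := @Rintegral_itvB R f (BLeft (- 2^-1)) (BRight 2^-1) 0
  (cts_itv_integrable (- 2^-1) 2^-1 cf).
rewrite !bnd_simp => /(_ _ _)/esym h.
rewrite -(Rintegral_itv_obnd_cbnd (r := 0)); last first.
  apply: integrableS (cts_itv_integrable 0 2^-1 cf) => //.
  by move=> x/=; rewrite !in_itv/= => /andP[/ltW -> ->].
by rewrite h ?subrKC//; lra.
Qed.

(** Closed form of the Fejer kernel, multiplied out so that it includes [t = 0]. With [w = 2 pi t],
    each half of the band contributes [2 - 2 cos (pi t)] to [w^2] times the transform. *)
Lemma cosint_triangle t : (pi * t) ^+ 2 * cosint triangle t = 1 - cos (pi * t).
Proof.
pose w := 2 * pi * t.
have ct := cts_triangle.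
have e2 x : 2 * pi * x * t = w * x by rewrite /w; ring.
have ew : w * 2^-1 = pi * t by rewrite /w; field.
have h1 : w ^+ 2 * Rintegral mu `[0, 2^-1] (fun x => cos (2 * pi * x * t) * triangle x) =
    2 - 2 * cos (pi * t).
  rewrite -RintegralZl//; last by apply: cts_itv_integrable; cts.
  transitivity (Rintegral mu `[0, 2^-1] (fun x => w ^+ 2 * (cos (w * x) * (1 - 2 * x)))).
    apply: eq_Rintegral => x; rewrite inE/= in_itv/= => /andP[x0 _].
    by rewrite e2 /triangle ger0_norm.
  have dF x : is_derive x 1 (fun x => w * (1 - 2 * x) * sin (w * x) - 2 * cos (w * x))
      (w ^+ 2 * (cos (w * x) * (1 - 2 * x))).
    by apply: is_derive_eq; rewrite /GRing.scale/=; ring.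
  rewrite (FTC_itv _ _ dF); [|by rewrite invr_ge0|by cts].
  by rewrite ew !mulr0 sin0 cos0 mulfV// subrr; ring.
have h2 : w ^+ 2 * Rintegral mu `[- 2^-1, 0] (fun x => cos (2 * pi * x * t) * triangle x) =
    2 - 2 * cos (pi * t).
  rewrite -RintegralZl//; last by apply: cts_itv_integrable; cts.
  transitivity (Rintegral mu `[- 2^-1, 0] (fun x => w ^+ 2 * (cos (w * x) * (1 + 2 * x)))).
    apply: eq_Rintegral => x; rewrite inE/= in_itv/= => /andP[_ x0].
    by rewrite e2 /triangle ler0_norm// mulrN opprK.
  have dF x : is_derive x 1 (fun x => w * (1 + 2 * x) * sin (w * x) + 2 * cos (w * x))
      (w ^+ 2 * (cos (w * x) * (1 + 2 * x))).
    by apply: is_derive_eq; rewrite /GRing.scale/=; ring.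
  rewrite (FTC_itv _ _ dF); [|by rewrite oppr_le0 invr_ge0|by cts].
  by rewrite [w * - _]mulrN cosN ew !mulr0 sin0 cos0 mulrN mulfV// subrr; ring.
have h : w ^+ 2 * cosint triangle t = 4 * (1 - cos (pi * t)).
  by rewrite /cosint band_split; [rewrite mulrDr h1 h2; ring|cts].
have {h} : 4 * ((pi * t) ^+ 2 * cosint triangle t) = 4 * (1 - cos (pi * t)).
  by rewrite -h /w; ring.
by apply: mulfI.
Qed.

Lemma triangle_ge0 x : band x -> 0 <= triangle x <= 1.
Proof.
move=> bx; have : `|x| < 2^-1 by rewrite band_normE; apply/asboolP.
by have := normr_ge0 x; rewrite /triangle => h1 h2; apply/andP; split; lra.
Qed.

Lemma cosint_triangle_ge0 t : 0 <= cosint triangle t.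
Proof.
have [->|t0] := eqVneq t 0.
  rewrite cosint0; apply: Rintegral_ge0 => x /triangle_ge0.
  by case/andP.
have w0 : 0 < (pi * t) ^+ 2 by rewrite exprn_even_gt0//= mulf_neq0// gt_eqF// pi_gt0.
by rewrite -(pmulr_rge0 _ w0) cosint_triangle subr_ge0 cos_le1.
Qed.

Lemma cosint_triangle_le1 t : cosint triangle t <= 1.
Proof.
have ct := cts_triangle.
apply: le_trans (ler_norm _) _; apply: band_norm_le; first by cts.
move=> x /triangle_ge0/andP[y0 y1]; rewrite normrM (ger0_norm y0).
by apply: le_trans y1; rewrite ler_piMl// cos_max.
Qed.

(** Writing [f] for the kernel, [f <= 1], and [4 t^2 f <= (pi t)^2 f = 1 - cos (pi t) <= 2]. *)
Lemma cosint_triangle_le t : cosint triangle t <= 2 * cauchyw 0 t.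
Proof.
rewrite /cauchyw subr0 ler_pdivlMr ?oneDsq_gt0//.
have h0 := cosint_triangle_ge0 t; have h1 := cosint_triangle_le1 t.
have h2 : 4 * (t ^+ 2 * cosint triangle t) <= 2.
  apply: (@le_trans _ _ ((pi * t) ^+ 2 * cosint triangle t)).
    rewrite exprMn -[leRHS]mulrA; apply: ler_wpM2r; first by rewrite mulr_ge0// sqr_ge0.
    rewrite (_ : 4 = 2 ^+ 2 :> R); last by ring.
    by rewrite ler_sqr ?nnegrE ?pi_ge0// pi_ge2.
  by rewrite cosint_triangle; have := cos_geN1 (pi * t); lra.
by lra.
Qed.

Lemma cauchyw_shift a t : cauchyw 0 (t - a) = cauchyw a t.
Proof. by rewrite /cauchyw subr0. Qed.

Lemma cts_cosint_shift (p : R -> R) a : continuous p -> continuous (fun t => cosint p (t - a)).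
Proof. by move=> cp; apply: derive_continuous => t; exact: derive_cosint. Qed.

Lemma integral_triangle_gt0 a :
  (0 < \int[mu]_t (cosint triangle (t - a))%:E)%E.
Proof.
rewrite lt_def integral_ge0 ?andbT; last by move=> t _; rewrite lee_fin cosint_triangle_ge0.
apply/eqP => /integral_eq0_cts h.
(* At [t = 1 + a] the closed form gives [pi^2 f(1) = 1 - cos pi = 2], so the kernel is not
   identically zero. *)
have /h/(_ _ (1 + a)) : continuous (fun t => cosint triangle (t - a)).
  by apply: cts_cosint_shift; exact: cts_triangle.
move=> /(_ (fun t => cosint_triangle_ge0 _))/=; rewrite addrK => z.
by have := cosint_triangle 1; rewrite z mulr0 mulr1 cospi; lra.
Qed.

(** The kernel lies between 0 and 1, so its square is below it and thus below [2 cauchyw a]. *)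
Lemma L2norm_triangle_lty a : (L2norm (cosT a triangle) ^+ 2 < +oo)%E.
Proof.
rewrite L2norm_sq.
have iw : mu.-integrable setT (EFin \o (fun t => 2 * cauchyw a t)).
  exact: (integrableZl measurableT _ (integrable_cauchyw a)).
have /integrableP[mw] := iw; apply: le_lt_trans.
apply: ge0_le_integral => //.
- by move=> t _; rewrite lee_fin sqr_ge0.
- apply/measurable_EFinP; apply: continuous_measurable_fun.
  have h := @cts_cosint_shift triangle a cts_triangle.
  have csq : continuous (fun t => `|cosint triangle (t - a)| ^+ 2) by cts.
  by under eq_fun do rewrite modulus_real; exact: csq.
- exact: measurableT_comp.
- move=> t _; rewrite modulus_real /= lee_fin real_normK ?num_real//.
  rewrite [leRHS]ger0_norm ?mulr_ge0 ?cauchyw_ge0// -cauchyw_shift.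
  apply: le_trans (cosint_triangle_le _).
  by rewrite expr2 ler_piMl ?cosint_triangle_ge0 ?cosint_triangle_le1.
Qed.

End TestFunction.

(** * Mass and concentration of the Gaussian symbols *)

Section Gaussian.
Context {R : realType}.
Local Notation mu := (@lebesgue_measure R).
Local Notation band := (@band R).
Implicit Types (x a b t : R).

Lemma sin_le_id x : 0 <= x -> `|sin x| <= x.
Proof.
move=> x0.
have [c _ e] := MVT_segment x0 (fun y _ => is_derive_sin y)
  (continuous_subspaceT (@continuous_sin R)).
by move: e; rewrite sin0 !subr0 => ->; rewrite normrM (ger0_norm x0) ler_piMl// cos_max.
Qed.

(** Half-angle formula: [1 - cos x = 2 sin^2 (x / 2)]. *)
Lemma cos_quad_le x : 1 - cos x <= x ^+ 2 / 2.
Proof.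
have {1}-> : x = (x / 2) *+ 2 by rewrite mulr2n -splitr.
rewrite cos_mulr2n cos2sin2.
have : sin (x / 2) ^+ 2 <= (x / 2) ^+ 2.
  rewrite -ler_sqrt ?sqr_ge0// !sqrtr_sqr.
  have [x0|x0] := leP 0 (x / 2); first by rewrite [leRHS]ger0_norm// sin_le_id.
  rewrite [leRHS]ltr0_norm// -[x / 2]opprK sinN normrN opprK.
  by apply: sin_le_id; rewrite oppr_ge0 ltW.
by rewrite exprMn; lra.
Qed.

(** The mass [G_k], which is also the transform of [gauss b k] at 0. *)
Definition gaussint b k : R := Rintegral mu band (gauss b k).

Lemma gauss_gt0 b k x : 0 < gauss b k x. Proof. exact: expR_gt0. Qed.

Lemma cosint_gauss_le b k t : `|cosint (gauss b k) t| <= gaussint b k.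
Proof.
have cg := @cts_gauss R b k.
apply: (@le_trans _ _ (Rintegral mu band (fun x => `|cos (2 * pi * x * t) * gauss b k x|))).
  apply: le_normr_Rintegral; first exact: measurable_band.
  by apply: cts_band_integrable; cts.
apply: band_le => //; first by cts.
move=> x _; rewrite normrM (gtr0_norm (gauss_gt0 b k x)) ler_piMl ?cos_max//.
exact: expR_ge0.
Qed.

(* Integrate the derivative of [x e^(- k b x^2)] over the band. *)
Lemma gauss_moment b k :
  2 * k%:R * b * Rintegral mu band (fun x => x ^+ 2 * gauss b k x) <= gaussint b k.
Proof.
have cg := @cts_gauss R b k.
have c2 : continuous (fun x => 2 * k%:R * b * (x ^+ 2 * gauss b k x)) by cts.
rewrite -RintegralZl; [|exact: measurable_band|by apply: cts_band_integrable; cts].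
rewrite -subr_ge0 /gaussint -RintegralB; [|exact: measurable_band|exact: cts_band_integrable..].
have dx x : is_derive x 1 (fun y : R => y * gauss b k y)
    (gauss b k x - 2 * k%:R * b * (x ^+ 2 * gauss b k x)).
  have d1 : is_derive x 1 (fun y : R => - (k%:R * (b * y ^+ 2))) (- (2 * k%:R * b * x)).
    by apply: is_derive_eq; rewrite /GRing.scale/=; ring.
  have d2 := derive_comp_val d1 (is_derive_expR _).
  have d3 := deriveM_val (is_derive_id x 1) d2.
  by apply: is_derive_eq d3 _; rewrite /gauss; ring.
(* The boundary terms [gauss b k (1/2) / 2] and [gauss b k (- 1/2) / 2] enter with a plus sign. *)
rewrite (FTC_band (ctsB cg c2) dx) mulNr opprK.
by rewrite addr_ge0// mulr_ge0 ?invr_ge0// ltW// gauss_gt0.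
Qed.

(** Since [1 - cos (2 pi x t) <= 2 (pi t)^2 x^2], the difference is controlled by the second moment,
    and [gauss_moment] makes the relative error of order [1 / k]. *)
Lemma cosint_gauss_dist b k t : 0 <= b ->
  k%:R * b * `|cosint (gauss b k) t - gaussint b k| <= (pi * t) ^+ 2 * gaussint b k.
Proof.
move=> b0; have cg := @cts_gauss R b k.
pose m2 := Rintegral mu band (fun x => x ^+ 2 * gauss b k x).
have kb : 0 <= k%:R * b by rewrite mulr_ge0.
apply: (@le_trans _ _ (k%:R * b * (2 * (pi * t) ^+ 2 * m2))); last first.
  have -> : k%:R * b * (2 * (pi * t) ^+ 2 * m2) = (pi * t) ^+ 2 * (2 * k%:R * b * m2) by ring.
  by apply: ler_wpM2l; [exact: sqr_ge0|exact: gauss_moment].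
apply: ler_wpM2l => //; rewrite distrC /gaussint /cosint.
rewrite -RintegralB; [|exact: measurable_band|exact: cts_band_integrable|]; last first.
  by apply: cts_band_integrable; cts.
rewrite -RintegralZl; [|exact: measurable_band|by apply: cts_band_integrable; cts].
have e x : gauss b k x - cos (2 * pi * x * t) * gauss b k x =
    (1 - cos (2 * pi * x * t)) * gauss b k x by rewrite mulrBl mul1r.
rewrite ger0_norm; last first.
  apply: Rintegral_ge0 => x _; rewrite e; apply: mulr_ge0; last exact: expR_ge0.
  by rewrite subr_ge0 cos_le1.
apply: band_le; [by cts..|move=> x _].
rewrite e mulrA; apply: ler_wpM2r; first exact: expR_ge0.
apply: le_trans (cos_quad_le _) _.
by rewrite !exprMn; lra.
Qed.

Lemma gaussint_lower b k : 0 <= b ->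
  expR (- b) / Num.sqrt (k.+1%:R) <= gaussint b k.+1.
Proof.
(* On [|x| < r] the exponent satisfies [(k + 1) b x^2 <= b / 4 <= b], the interval has length
   [2 r = 1 / sqrt (k + 1)], and [r <= 1/2] keeps it within the band. *)
move=> b0; pose r : R := (2 * Num.sqrt k.+1%:R)^-1.
have s1 : 1 <= Num.sqrt k.+1%:R :> R.
  by rewrite -{1}sqrtr1 ler_sqrt ?ler1n// ler0n.
have r0 : 0 < r by rewrite invr_gt0; lra.
have r2 : r <= 2^-1 by rewrite lef_pV2 ?posrE//; lra.
pose I := `]- r, r[%classic.
have mI : measurable I by exact: measurable_itv.
have cg := @cts_gauss R b k.+1.
have ig := cts_band_integrable cg.
rewrite -lee_fin /gaussint /Rintegral fineK; last first.
  by apply: integrable_fin_num; [exact: measurable_band|exact: ig].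
have IB : I `<=` band.
  by move=> x; rewrite /I /Defs.band/= !in_itv/= => /andP[h1 h2]; apply/andP; split; lra.
have mg : measurable_fun setT (EFin \o gauss b k.+1).
  by apply/measurable_EFinP; exact: continuous_measurable_fun.
have -> : (expR (- b) / Num.sqrt k.+1%:R)%:E = (\int[mu]_(x in I) (expR (- b))%:E)%E.
  rewrite integral_cst// [X in (_ * X)%E](_ : _ = (2 * r)%:E).
    by rewrite -EFinM; congr EFin; rewrite /r; field; rewrite gt_eqF//; lra.
  apply: etrans (lebesgue_measure_itv _) _ => /=.
  rewrite lte_fin ifT; last by lra.
  by rewrite -EFinB; congr EFin; lra.
apply: (@le_trans _ _ (\int[mu]_(x in I) (gauss b k.+1 x)%:E)%E); last first.
  apply: ge0_subset_integral => //; first exact: measurable_band.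
    exact: (measurable_funS measurableT).
  by move=> x _; rewrite lee_fin expR_ge0.
apply: ge0_le_integral => //.
- exact: (measurable_funS measurableT).
- move=> x; rewrite /I/= in_itv/= => /andP[h1 h2]; rewrite lee_fin ler_expR lerN2.
  rewrite mulrCA ler_piMr//.
  have : x ^+ 2 <= r ^+ 2.
    by rewrite -ler_sqrt ?sqr_ge0// !sqrtr_sqr (gtr0_norm r0) ler_norml; apply/andP; split; lra.
  rewrite /r exprVn exprMn sqr_sqrtr// => h.
  have k0 : 0 < k.+1%:R :> R by rewrite ltr0n.
  have := ler_wpM2l (ltW k0) h.
  have -> : k.+1%:R * (2 ^+ 2 * k.+1%:R)^-1 = (2 ^+ 2)^-1 :> R.
    by rewrite invfM mulrCA mulfV ?gt_eqF// mulr1.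
  move=> h'; apply: le_trans h' _.
  by rewrite invf_le1 ?exprn_gt0// expr2; lra.
Qed.

Lemma gaussint_sq_lower b k : 0 <= b ->
  expR (- b) ^+ 2 * harmonic k <= gaussint b k.+1 ^+ 2.
Proof.
move=> b0; have := gaussint_lower k b0.
have h0 : 0 <= expR (- b) / Num.sqrt (k.+1%:R) by rewrite divr_ge0 ?expR_ge0// sqrtr_ge0.
move=> h; have : (expR (- b) / Num.sqrt k.+1%:R) ^+ 2 <= gaussint b k.+1 ^+ 2.
  by rewrite ler_sqr ?nnegrE// (le_trans h0).
by rewrite exprMn exprVn sqr_sqrtr.
Qed.

End Gaussian.

(** * Asymptotics of the scalar products and divergence of their sum of squares *)

Section Pairing.
Context {R : realType}.
Local Notation mu := (@lebesgue_measure R).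
Implicit Types (a b t : R).

Lemma gaussint_gt0 b k : 0 <= b -> 0 < gaussint b k.+1.
Proof.
move=> b0; apply: lt_le_trans (gaussint_lower k b0).
by rewrite divr_gt0 ?expR_gt0// sqrtr_gt0 ltr0n.
Qed.

(** The integrand of the pairing divided by the mass, which makes it converge as [n] grows. The
    index [n.+1] matches [harmonic n = 1 / (n + 1)]. *)
Definition pairing_ratio a b n t : R :=
  cosint triangle (t - a) * (cosint (gauss b n.+1) (t - a) / gaussint b n.+1).

Lemma cts_pairing_ratio a b n : continuous (pairing_ratio a b n).
Proof.
have h1 := @cts_cosint_shift R triangle a (@cts_triangle R).
have h2 := @cts_cosint_shift R (gauss b n.+1) a (@cts_gauss R b n.+1).
by rewrite /pairing_ratio; cts.
Qed.

Lemma pairing_ratio_le a b n t : 0 <= b ->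
  `|pairing_ratio a b n t| <= 2 * cauchyw a t.
Proof.
move=> b0; have g0 := gaussint_gt0 n b0.
rewrite /pairing_ratio normrM (ger0_norm (cosint_triangle_ge0 _)).
apply: (@le_trans _ _ (cosint triangle (t - a))).
  rewrite ler_piMr ?cosint_triangle_ge0// normf_div (gtr0_norm g0).
  by rewrite ler_pdivrMr// mul1r cosint_gauss_le.
by apply: le_trans (cosint_triangle_le _) _; rewrite cauchyw_shift.
Qed.

Lemma cvg_pairing_ratio a b t : 0 < b ->
  pairing_ratio a b n t @[n --> \oo] --> cosint triangle (t - a).
Proof.
move=> b0; rewrite -[X in _ --> X]mulr1; apply: cvgM; first exact: cvg_cst.
set s := t - a; apply/subr_cvg0.
(* Dividing [cosint_gauss_dist] by [(n + 1) b] and by the mass gives the rate [c / (n + 1)]. *)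
pose c := (pi * s) ^+ 2 / b.
have c0 : (fun n => c * harmonic n) @ \oo --> (0 : R).
  by rewrite -(mulr0 c); apply: cvgM; [exact: cvg_cst|exact: cvg_harmonic].
apply: norm_cvg0; apply: (@squeeze_cvgr _ _ _ _ (cst 0) (fun n => c * harmonic n)) => //; last exact: cvg_cst.
apply: nearW => n; rewrite normr_ge0/=.
have g0 := gaussint_gt0 n (ltW b0).
have kb : 0 < n.+1%:R * b by rewrite mulr_gt0// ltr0n.
rewrite -[X in _ / _ - X](divff (lt0r_neq0 g0)) -mulrBl normf_div (gtr0_norm g0).
rewrite ler_pdivrMr// -(ler_pM2l kb).
apply: le_trans (cosint_gauss_dist n.+1 s (ltW b0)) _.
rewrite /c /harmonic/= le_eqVlt; apply/orP; left; apply/eqP.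
by field; rewrite (gt_eqF b0) nat1r pnatr_eq0.
Qed.

(* Dominated convergence, with majorant [2 cauchyw a]. *)
Lemma pairing_lower a b : 0 < b -> exists2 c : R, 0 < c &
  \forall n \near \oo,
    c * gaussint b n.+1 <=
    Rintegral mu setT (fun t => cosint triangle (t - a) * cosint (gauss b n.+1) (t - a)).
Proof.
move=> b0.
have iw : mu.-integrable setT (EFin \o (fun t => 2 * cauchyw a t)).
  exact: (integrableZl measurableT _ (integrable_cauchyw a)).
have mr n : measurable_fun setT (EFin \o pairing_ratio a b n).
  by apply/measurable_EFinP; apply: continuous_measurable_fun; exact: cts_pairing_ratio.
have ir n : mu.-integrable setT (EFin \o pairing_ratio a b n).
  apply: le_integrable iw => //; [exact: mr|move=> t _; rewrite /= lee_fin].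
  by apply: le_trans (pairing_ratio_le a n t (ltW b0)) _; exact: ler_norm.
have it : mu.-integrable setT (EFin \o (fun t => cosint triangle (t - a))).
  apply: le_integrable iw => //.
    apply/measurable_EFinP; apply: continuous_measurable_fun.
    by apply: cts_cosint_shift; exact: cts_triangle.
  move=> t _; rewrite /= lee_fin (ger0_norm (cosint_triangle_ge0 _)).
  apply: le_trans (ler_norm _); rewrite -cauchyw_shift.
  exact: cosint_triangle_le.
have cvgI : (\int[mu]_t (pairing_ratio a b n t)%:E)%E @[n --> \oo] -->
    (\int[mu]_t (cosint triangle (t - a))%:E)%E.
  apply: (@dominated_cvg _ _ _ mu _ measurableT
    (fun n => EFin \o pairing_ratio a b n) _ (EFin \o (fun t => 2 * cauchyw a t))) => //.
  - move=> t _; apply: cvg_EFin; first exact: nearW.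
    exact: cvg_pairing_ratio.
  - by move=> n t _; rewrite /= lee_fin; apply: pairing_ratio_le; exact: ltW.
have I0 := integral_triangle_gt0 a.
have fI := integrable_fin_num measurableT it.
set I := (\int[mu]_t (cosint triangle (t - a))%:E)%E in cvgI I0 fI.
have {I0} J0 : 0 < fine I by rewrite fine_gt0// I0/= ltey_eq fI.
(* The integrals of the ratios tend to [fine I > 0], hence eventually exceed half of it. *)
exists (fine I / 2); first by rewrite divr_gt0.
have /fine_cvgP[_] : (\int[mu]_t (pairing_ratio a b n t)%:E)%E @[n --> \oo] --> (fine I)%:E.
  by rewrite fineK.
move=> /(cvgr_gt (fine I)) /(_ (fine I / 2)) h.
have : fine I / 2 < fine I by lra.
move=> /h; apply: filterS => n /= hn.
have g0 := gaussint_gt0 n (ltW b0).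
have -> : Rintegral mu setT (fun t => cosint triangle (t - a) * cosint (gauss b n.+1) (t - a)) =
    Rintegral mu setT (fun t => gaussint b n.+1 * pairing_ratio a b n t).
  apply: eq_Rintegral => t _; rewrite /pairing_ratio.
  by field; rewrite gt_eqF.
rewrite RintegralZl//.
by rewrite mulrC ler_pM2l//; exact: ltW.
Qed.

(** The integral is the real part of the scalar product; discarding the square of the imaginary part
    leaves a lower bound, which is enough for divergence. *)
Lemma L2dot_cosT_ge a (p q : R -> R) :
  Rintegral mu setT (fun t => cosint p (t - a) * cosint q (t - a)) ^+ 2 <=
  modulus (L2dot (cosT a p) (cosT a q)) ^+ 2.
Proof.
rewrite modulus_sq /=.
rewrite [X in _ <= X ^+ 2 + _](_ : _ =
  Rintegral mu setT (fun t => cosint p (t - a) * cosint q (t - a))).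
  by rewrite lerDl sqr_ge0.
by apply: eq_Rintegral => t _; rewrite /re_fun/= oppr0 mulr0 subr0.
Qed.

(** Comparison test: a finite sum [V] would bound the harmonic partial sums by their first [N] terms
    plus [V / c], making the harmonic series converge. *)
Lemma nneseries_harmonic_pinfty (v : nat -> R) c : 0 < c ->
  (forall k, 0 <= v k) -> (\forall k \near \oo, c * harmonic k <= v k.+1) ->
  (\sum_(0 <= k <oo) (v k)%:E = +oo)%E.
Proof.
move=> c0 v0 [N _ hv]; apply/eqP; rewrite -leye_eq leNgt; apply/negP => fin.
have sum0 : (0 <= \sum_(0 <= k <oo) (v k)%:E)%E.
  by apply: nneseries_ge0 => k _ _; rewrite lee_fin.
pose V := fine (\sum_(0 <= k <oo) (v k)%:E)%E.
have VE : (V%:E = \sum_(0 <= k <oo) (v k)%:E)%E by rewrite fineK// ge0_fin_numE.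
have part n : \sum_(0 <= k < n) v k <= V.
  rewrite -lee_fin VE -sumEFin.
  by apply: nneseries_lim_ge => k _ _; rewrite lee_fin.
apply: (@dvg_harmonic R); apply: nondecreasing_is_cvgn.
  by apply: nondecreasing_series => k _ _; exact: harmonic_ge0.
exists (\sum_(0 <= k < N) harmonic k + c^-1 * V) => _ [n _ <-].
apply: (@le_trans _ _ (series (@harmonic R) (N + n)%N)).
  apply: (@nondecreasing_series _ (@harmonic R) predT 0) => [k _ _|]; first exact: harmonic_ge0.
  exact: leq_addl.
rewrite /series/= (big_cat_nat (n := N))//= ?leq_addr// lerD2l.
rewrite -(ler_pM2l c0) mulVKf ?gt_eqF// mulr_sumr.
apply: le_trans (part (N + n)%N.+1).
(* Splitting off [v 0] realigns the indices, [harmonic k] being compared with [v k.+1]. *)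
rewrite big_nat_recl// (big_cat_nat (m := 0) (n := N))//= ?leq_addr//.
apply: (@le_trans _ _ (\sum_(N <= k < (N + n)%N) v k.+1)).
  rewrite [leLHS]big_nat_cond [leRHS]big_nat_cond.
  by apply: ler_sum => k; rewrite andbT => /andP[Nk _]; exact: hv.
by rewrite addrA lerDr addr_ge0// sumr_ge0.
Qed.

End Pairing.

(** * Failure of the Bessel bound at the translated Fejer kernel *)

Theorem proposition6p1 (R : realType) (delta : R) (delta_gt0 : 0 < delta)
  (i : int) :
  ~ bessel_BL (fun k : nat => iter k (opA delta) (sinc_translate i)).
Proof.
set a : R := i%:~R; set b := delta * (2 * pi) ^+ 2.
have b0 : 0 < b by rewrite mulr_gt0// exprn_gt0// mulr_gt0// pi_gt0.
have iterE k : iter k (opA delta) (sinc_translate i) = cosT a (gauss b k).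
  elim: k => [|k IH]; first exact: sinc_translateE.
  by rewrite iterS IH opA_cosT_gauss.
move=> [C C0 bes].
have yBL : BL (cosT a triangle).
  by apply: BL_cosT; [exact: cts_triangle|move=> x; rewrite /triangle normrN].
have := bes _ yBL.
have [c c0 hc] := pairing_lower a b0.
(* The factor [c] compares the pairing with the mass and [expR (- b)] the mass with
   [1 / sqrt (k + 1)]; both are squared. The Bessel bound would then equal [+oo], although the
   kernel has finite norm. *)
rewrite (@nneseries_harmonic_pinfty _ _ (c ^+ 2 * expR (- b) ^+ 2)).
- rewrite leye_eq => /eqP e.
  suff : (C%:E * L2norm (cosT a triangle) ^+ 2 < +oo)%E by rewrite e ltxx.
  by apply: lte_mul_pinfty => //; [rewrite lee_fin ltW|exact: L2norm_triangle_lty].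
- by rewrite mulr_gt0// exprn_gt0// expR_gt0.
- by move=> k; exact: sqr_ge0.
- apply: filterS hc => k hk; rewrite iterE.
  apply: le_trans (L2dot_cosT_ge a triangle (gauss b k.+1)).
  have cg : 0 <= c * gaussint b k.+1.
    by rewrite mulr_ge0 ?ltW// gaussint_gt0// ltW.
  apply: (@le_trans _ _ ((c * gaussint b k.+1) ^+ 2)); last first.
    by rewrite ler_sqr ?nnegrE// (le_trans cg).
  rewrite exprMn -mulrA ler_wpM2l ?sqr_ge0//.
  by apply: gaussint_sq_lower; exact: ltW.
Qed.
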